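(* Let $n\ge 2$ be even, let $x_0\neq x_1$ be two points of a set $\mathsf{X}$, let $1/2\le\omega<1$, and let $f:\mathsf{X}\to\mathbb{R}$; put $|f|=|f(x_1)-f(x_0)|$. Consider the $n$ particles $$(\xi^1,\dots,\xi^n)=(x_0,x_1,x_0,x_1,\dots,x_0,x_1),$$ where each particle equal to $x_1$ has weight $2\omega/n$ and each particle equal to $x_0$ has weight $2(1-\omega)/n$. Resample $n$ particles $\tilde\xi^1,\dots,\tilde\xi^n$ from this weighted system. Then the variance (over the resampling randomness, the particles and weights being fixed) of $\frac1n\sum_{i=1}^n f(\tilde\xi^i)$ equals 1. $\frac1n(1-\omega)\,\omega\,|f|^2$ under multinomial resampling; 2. $\frac1n(2\omega-1)(1-\omega)|f|^2$ under residual resampling and under stratified resampling; 3. $(\omega-\tfrac12)(1-\omega)|f|^2$ under systematic resampling. Consequently, systematic resampling does not always have conditional variance at most that of multinomial resampling; moreover, for fixed $\omega\in(1/2,1)$ with $f(x_0)\ne f(x_1)$, the variance under systematic resampling does not decrease to zero as $n\to\infty$.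
   Context: For weights $\omega^1,\dots,\omega^n\ge0$ with $\sum_i\omega^i=1$ and $u\in(0,1]$ let $D^{\mathrm{inv}}(u)=i$ if $u\in(\sum_{j=1}^{i-1}\omega^j,\sum_{j=1}^{i}\omega^j]$ (particles are taken in the listed order). Multinomial, stratified and systematic resampling all set $\tilde\xi^i=\xi^{D^{\mathrm{inv}}(U^i)}$, $i=1,\dots,n$, where: - multinomial: $U^1,\dots,U^n$ are i.i.d. uniform on $(0,1]$; - stratified: $U^1,\dots,U^n$ are independent and $U^i$ is uniform on $((i-1)/n,i/n]$; - systematic: $U^i=(i-1)/n+U$ with a single $U$ uniform on $(0,1/n]$. Residual resampling: with $R=\sum_i\lfloor n\omega^i\rfloor$, particle $\xi^i$ is copied $\lfloor n\omega^i\rfloor+\bar N^i$ times, where $(\bar N^1,\dots,\bar N^n)$ is multinomial with $n-R$ trials and probabilities $(n\omega^i-\lfloor n\omega^i\rfloor)/(n-R)$ (if $R=n$, all $\bar N^i=0$). *)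

(* Defs.v *)
From HB Require Import structures.
From mathcomp Require Import all_boot all_order all_algebra.
From mathcomp Require Import all_classical all_reals all_analysis.

Set Implicit Arguments.
Unset Strict Implicit.
Unset Printing Implicit Defensive.

Import Order.TTheory GRing.Theory Num.Theory.
Import numFieldNormedType.Exports.

Local Open Scope classical_set_scope.
Local Open Scope ring_scope.

(* Particles are numbered from 0, i.e. by ['I_n]. A resampling scheme is a
   relation [scheme P w A] saying that, on the probability space [P], the random
   indices [A : 'I_n -> T -> 'I_n] are obtained by resampling according to the
   weights [w]: the k-th resampled particle is [xi (A k t)]. *)

Definition is_weights (R : realType) (n : nat) (w : 'I_n -> R) : Prop :=
  (forall i, 0 <= w i) /\ \sum_(i < n) w i = 1.

(* For weights [w], at most one index satisfies the condition, and exactly one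
   does when 0 < u <= 1. For the other values of [u], which the uniform
   variables below take with probability 0, the value is the dummy [k]. *)
Definition Dinv (R : realType) (n : nat) (w : 'I_n -> R) (k : 'I_n) (u : R) :
    'I_n :=
  odflt k [pick i : 'I_n | \sum_(j < n | (j < i)%N) w j < u
                             <= \sum_(j < n | (j <= i)%N) w j].

Definition mutually_independent d (T : measurableType d) (R : realType)
    (P : probability T R) (n : nat) (U : 'I_n -> {RV P >-> R}) : Prop :=
  forall (J : {set 'I_n}) (B : 'I_n -> set R),
    (forall i, measurable (B i)) ->
    P (\bigcap_(i in [set` J]) (U i @^-1` B i)) =
    (\prod_(i in J) P (U i @^-1` B i))%E.

(* The uniform law on ]a, b] is that on [a, b], the endpoints being null. *)
Definition has_uniform_law d (T : measurableType d) (R : realType)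
    (P : probability T R) (U : {RV P >-> R}) (a b : R) : Prop :=
  exists ab : a < b,
    forall B : set R, measurable B -> distribution P U B = uniform_prob ab B.

Definition has_multinomial_law d (T : measurableType d) (R : realType)
    (P : probability T R) (n : nat) (N : 'I_n -> {RV P >-> nat})
    (m : nat) (p : 'I_n -> R) : Prop :=
  forall c : 'I_n -> nat,
    P [set t | forall i, N i t = c i] =
    (if (\sum_(i < n) c i)%N == m
     then m`!%:R / (\prod_(i < n) (c i)`!)%N%:R * \prod_(i < n) p i ^+ c i
     else 0)%:E.

Definition multinomial_resampling d (T : measurableType d) (R : realType)
    (P : probability T R) (n : nat) (w : 'I_n -> R)
    (A : 'I_n -> T -> 'I_n) : Prop :=
  exists U : 'I_n -> {RV P >-> R},
    [/\ mutually_independent U,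
        forall i, has_uniform_law (U i) 0 1
      & forall i t, A i t = Dinv w i (U i t)].

Definition stratified_resampling d (T : measurableType d) (R : realType)
    (P : probability T R) (n : nat) (w : 'I_n -> R)
    (A : 'I_n -> T -> 'I_n) : Prop :=
  exists U : 'I_n -> {RV P >-> R},
    [/\ mutually_independent U,
        forall i : 'I_n, has_uniform_law (U i) (i%:R / n%:R) (i.+1%:R / n%:R)
      & forall i t, A i t = Dinv w i (U i t)].

Definition systematic_resampling d (T : measurableType d) (R : realType)
    (P : probability T R) (n : nat) (w : 'I_n -> R)
    (A : 'I_n -> T -> 'I_n) : Prop :=
  exists U : {RV P >-> R},
    has_uniform_law U 0 n%:R^-1 /\
    forall i t, A i t = Dinv w i (i%:R / n%:R + U t).

(* Only the number of copies of each particle is prescribed, the order in which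
   the copies are listed being irrelevant. If n - R = 0 then the probabilities
   are dummies (x / 0 = 0) and all the [N i] are 0 (no trials). *)
Definition residual_resampling d (T : measurableType d) (R : realType)
    (P : probability T R) (n : nat) (w : 'I_n -> R)
    (A : 'I_n -> T -> 'I_n) : Prop :=
  let floor_copies i := Num.truncn (n%:R * w i) in
  let m := (n - \sum_(i < n) floor_copies i)%N in
  exists N : 'I_n -> {RV P >-> nat},
    has_multinomial_law N m
      (fun i => (n%:R * w i - (floor_copies i)%:R) / m%:R) /\
    forall i t, #|[set k | A k t == i]%SET| = (floor_copies i + N i t)%N.

Definition resampled_mean d (T : measurableType d) (R : realType) (X : Type)
    (n : nat) (f : X -> R) (xi : 'I_n -> X) (A : 'I_n -> T -> 'I_n) : T -> R :=
  fun t => n%:R^-1 * \sum_(k < n) f (xi (A k t)).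

Definition alternating_particles (X : Type) (x0 x1 : X) (n : nat) : 'I_n -> X :=
  fun i => if odd i then x1 else x0.

Definition alternating_weights (R : realType) (omega : R) (n : nat) :
    'I_n -> R :=
  fun i => if odd i then 2 * omega / n%:R else 2 * (1 - omega) / n%:R.
Arguments alternating_particles {X} x0 x1 n.
Arguments alternating_weights {R} omega n.

(* Main.v *)
Require Import Defs.
From HB Require Import structures.
From mathcomp Require Import all_boot all_order all_algebra.
From mathcomp Require Import all_classical all_reals all_analysis.
From mathcomp Require Import ring lra measurable_realfun.

Set Implicit Arguments.
Unset Strict Implicit.
Unset Printing Implicit Defensive.

Import Order.TTheory GRing.Theory Num.Theory.
Import numFieldNormedType.Exports.

Local Open Scope classical_set_scope.
Local Open Scope ring_scope.

(** Up to an affine change of variable the resampled mean is the number of odd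
    resampled indices. Under the inverse distribution function, the i-th stratum
    ](i-1)/n, i/n] (counting from 1) is sent to x1 for even i, and to x0 or x1
    with probabilities 2(1 - omega) and 2 omega - 1 for odd i. The n/2
    undetermined choices are independent under stratified resampling, whereas
    under systematic resampling they are all equal, which multiplies their
    variance by n/2 and makes it independent of n. Under residual resampling the
    number of random copies of x1 is binomial with n/2 trials and success
    probability 2 omega - 1. *)

(** * Variance of sums of indicators *)

Section finite_expectations.
Context d (T : measurableType d) (R : realType) (P : probability T R).

(** Integrability is bundled with the value so that linearity applies without side conditions. *)
Definition has_mean (Y : T -> R) (v : R) : Prop :=
  P.-integrable setT (EFin \o Y) /\ (\int[P]_t (Y t)%:E = v%:E)%E.

Lemma has_mean_indic (E : set T) : measurable E -> has_mean \1_E (fine (P E)).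
Proof.
move=> mE; split; first exact: integrable_indic.
by rewrite integral_indic// setIT fineK// fin_num_measure.
Qed.

Lemma has_meanD (Y Z : T -> R) (v w : R) :
  has_mean Y v -> has_mean Z w -> has_mean (fun t => Y t + Z t) (v + w).
Proof.
move=> [iY EY] [iZ EZ]; split.
  by have := integrableD measurableT iY iZ.
by rewrite integralD_EFin// EY EZ.
Qed.

Lemma has_meanZ (k : R) (Y : T -> R) (v : R) :
  has_mean Y v -> has_mean (fun t => k * Y t) (k * v).
Proof.
move=> [iY EY]; split; first by have := integrableZl measurableT k iY.
by under eq_integral do rewrite EFinM; rewrite integralZl// EY.
Qed.

Lemma has_mean_cst (k : R) : has_mean (fun=> k) k.
Proof.
split; first exact: finite_measure_integrable_cst.
by rewrite integral_cst//= probability_setT mule1.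
Qed.

Lemma has_mean_sum (J : Type) (r : seq J) (Y : J -> T -> R) (v : J -> R) :
  (forall j, has_mean (Y j) (v j)) ->
  has_mean (fun t => \sum_(j <- r) Y j t) (\sum_(j <- r) v j).
Proof.
move=> h; elim: r => [|j r IH].
  rewrite big_nil; under eq_fun do rewrite big_nil; exact: has_mean_cst.
by rewrite big_cons; under eq_fun do rewrite big_cons; exact: has_meanD.
Qed.

(** [phi (Z t)] is a finite linear combination of the indicators of the fibres of [Z]. *)
Lemma has_mean_finite_range (J : finType) (Z : T -> J) (phi : J -> R) :
  (forall j, measurable [set t | Z t = j]) ->
  has_mean (fun t => phi (Z t)) (\sum_j phi j * fine (P [set t | Z t = j])).
Proof.
move=> mZ.
rewrite (_ : (fun t => phi (Z t)) =
    fun t => \sum_j phi j * \1_([set t | Z t = j]) t).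
  by apply: has_mean_sum => j; apply/has_meanZ/has_mean_indic.
apply/funext => t; rewrite (bigD1 (Z t))//= indicE mem_set// mulr1.
rewrite big1 ?addr0// => j /eqP jZ; rewrite indicE memNset ?mulr0//=.
exact/nesym.
Qed.

Lemma variance_affine (S : T -> R) (m v a b : R) :
  has_mean S m -> has_mean (fun t => (S t - m) ^+ 2) v ->
  'V_P[fun t => b + a * S t] = (a ^+ 2 * v)%:E.
Proof.
move=> hS hS2.
have [_ EY] := has_meanD (has_mean_cst b) (has_meanZ a hS).
rewrite /variance unlock.
have -> : ('E_P[fun t => (b + a * S t)%R] = (b + a * m)%:E)%E by rewrite unlock.
rewrite unlock /=.
have [_ <-] := has_meanZ (a ^+ 2) hS2.
by apply: eq_integral => t _; rewrite !fctE /=; congr EFin; ring.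
Qed.

(** The square of the centred sum expands into pairwise covariances. Only pairs of events enter, so
    independent and fully dependent choices are treated alike. *)
Lemma variance_sum_indic (n : nat) (E : 'I_n -> set T) (a b : R) :
  (forall i, measurable (E i)) ->
  'V_P[fun t => b + a * \sum_(i < n) \1_(E i) t] =
  (a ^+ 2 * \sum_(i < n) \sum_(j < n)
    (fine (P (E i `&` E j)) - fine (P (E i)) * fine (P (E j))))%:E.
Proof.
move=> mE; set p := fun i => fine (P (E i)).
have hE i : has_mean \1_(E i) (p i) by exact: has_mean_indic.
apply: (variance_affine _ _ (has_mean_sum _ hE)).
have -> : (fun t => (\sum_(i < n) \1_(E i) t - \sum_(i < n) p i) ^+ 2) =
    (fun t => \sum_(i < n) \sum_(j < n) (\1_(E i `&` E j) t +
       (- p i * \1_(E j) t + (- p j * \1_(E i) t + p i * p j)))).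
  apply/funext => t; rewrite -sumrB expr2 mulr_suml; apply: eq_bigr => i _.
  rewrite mulr_sumr; apply: eq_bigr => j _.
  by rewrite indicI /=; ring.
apply: has_mean_sum => i; apply: has_mean_sum => j.
rewrite (_ : _ - _ = fine (P (E i `&` E j)) +
  (- p i * p j + (- p j * p i + p i * p j))); last by rewrite /p; ring.
apply: has_meanD; first by apply: has_mean_indic; exact: measurableI.
apply: has_meanD; first exact: has_meanZ.
by apply: has_meanD; [exact: has_meanZ|exact: has_mean_cst].
Qed.

End finite_expectations.

(** * Uniform variables and the inverse distribution function *)

(** Agreement of [B] with []c, e]] is asked on the open interval only, the endpoints being null; the
    values of [Dinv] there, possibly dummies, never have to be examined. *)
Lemma uniform_prob_itv (R : realType) (a b : R) (ab : a < b) (B : set R)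
    (c e : R) : measurable B -> a <= c -> c <= e -> e <= b ->
  (forall u, a < u -> u < b -> B u <-> c < u <= e) ->
  uniform_prob ab B = ((e - c) / (b - a))%:E.
Proof.
move=> mB ac ce eb BE.
have := @integral_uniform R a b ab (fun u => (\1_B u)%:E).
rewrite integral_indic// setIT => ->; last 2 first.
- by apply/measurable_EFinP; exact: measurable_indic.
- by move=> u; rewrite lee_fin.
have mI (D : set R) : measurable D ->
    measurable_fun `]a, b[ (EFin \o \1_D : R -> \bar R).
  move=> mD; apply/measurable_EFinP/measurable_funTS.
  exact: measurable_indic.
rewrite integral_itv_bndoo; last exact: mI.
have -> : (\int[lebesgue_measure]_(u in `]a, b[) (\1_B u)%:E =
    \int[lebesgue_measure]_(u in `]a, b[) (\1_(`]c, e]) u)%:E)%E.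
  apply: eq_integral => u.
  rewrite inE/= in_itv/= => /andP[au ub]; rewrite !indicE.
  suff -> : (u \in B) = (u \in `]c, e]%classic) by [].
  apply/idP/idP; rewrite !inE/= in_itv/=; first by move/(BE _ au ub).
  by move=> h; apply/(BE _ au ub).
(* [false false] selects []a, b]], which contains []c, e]] even when [e = b]. *)
rewrite -(@integral_itv_bndoo _ _ _ _ false false); last exact: mI.
rewrite integral_indic//.
rewrite (_ : _ `&` _ = `]c, e]%classic); last first.
  apply/seteqP; split => u /=; rewrite !in_itv/=; first by case.
  by move=> /andP[cu ue]; split; apply/andP; split=> //; lra.
have L : lebesgue_measure (`]c, e]%classic : set R) = (e - c)%:E.
  rewrite lebesgue_measure_itv/= lte_fin; case: ltP => [_|ec].
    by rewrite -EFinB.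
  by have -> : e = c by [lra]; rewrite subrr.
transitivity ((b - a)^-1%:E * (e - c)%:E)%E; first by congr (_ * _)%E; exact: L.
by rewrite -EFinM mulrC.
Qed.

Section inverse_distribution.
Context (R : realType) (n : nat) (w : 'I_n -> R).

(** With this strict bound the bracket of [i] in [Dinv] reads [cumw i < u <= cumw i.+1]; the [nat]
    argument allows the total [cumw n]. *)
Definition cumw (m : nat) : R := \sum_(j < n | (j < m)%N) w j.

Lemma cumwS (i : 'I_n) : cumw i.+1 = cumw i + w i.
Proof.
rewrite /cumw (bigD1 i)//= addrC; congr (_ + _); apply: eq_bigl => j.
by rewrite ltnS ltn_neqAle andbC.
Qed.

(** [Dinv] depends on [u] only through the finite boolean vector [Z u] of bracket memberships, so
    the preimage is a finite union of finite intersections of brackets and their complements. *)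
Lemma measurable_Dinv_preimage (k : 'I_n) (Q : pred 'I_n) :
  measurable [set u : R | Q (Dinv w k u)].
Proof.
pose Z u : {ffun 'I_n -> bool} := [ffun i : 'I_n => cumw i < u <= cumw i.+1].
pose g (b : {ffun 'I_n -> bool}) := odflt k [pick i | b i].
have DE u : Dinv w k u = g (Z u).
  by congr odflt; apply: eq_pick => i; rewrite ffunE.
rewrite (_ : mkset _ = \bigcup_(b in [set b | Q (g b)])
    \bigcap_(i in [set: 'I_n]) [set u | (cumw i < u <= cumw i.+1) = b i]).
  apply: fin_bigcup_measurable => // b _.
  apply: fin_bigcap_measurable => // i _.
  case: (b i).
    by rewrite (_ : mkset _ = `]cumw i, cumw i.+1]%classic).
  rewrite (_ : mkset _ = ~` `]cumw i, cumw i.+1]%classic).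
    exact: measurableC.
  by apply/seteqP; split=> u /=; rewrite in_itv/=; [move=> ->|move/negP/negbTE].
apply/seteqP; split=> u /=; rewrite DE.
  by move=> Qu; exists (Z u) => // i _ /=; rewrite ffunE.
move=> [b Qb] /= bu; rewrite (_ : Z u = b)//.
by apply/ffunP => i; rewrite ffunE; exact: bu.
Qed.

Hypothesis w_ge0 : forall i, 0 <= w i.

Lemma le_cumw (m p : nat) : (m <= p)%N -> cumw m <= cumw p.
Proof.
move=> mp; rewrite /cumw big_mkcond [leRHS]big_mkcond; apply: ler_sum => j _.
by case: ifPn => [jm|_]; [rewrite (leq_trans jm)|case: ifP].
Qed.

(** Cumulative weights are nondecreasing, so brackets of distinct indices are disjoint. *)
Lemma Dinv_eq (k i : 'I_n) (u : R) :
  cumw i < u <= cumw i.+1 -> Dinv w k u = i.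
Proof.
move=> /andP[iu ui]; rewrite /Dinv; case: pickP => /= [j|/(_ i)]; last first.
  by rewrite -/(cumw i) -/(cumw i.+1) iu ui.
rewrite -/(cumw j) -/(cumw j.+1) => /andP[ju uj].
have [ij|ji|/val_inj//] := ltngtP i j.
- by have := le_lt_trans (le_cumw ij) ju; rewrite ltNge ui.
- by have := le_lt_trans (le_cumw ji) iu; rewrite ltNge uj.
Qed.

Hypothesis w_sum1 : \sum_(i < n) w i = 1.

(** The bracket is found at the predecessor of the least [m] with [u <= cumw m]; such an [m] exists
    because the weights sum to 1, and it is positive because [u > 0]. *)
Lemma Dinv_bracket (k : 'I_n) (u : R) : 0 < u -> u <= 1 ->
  cumw (Dinv w k u) < u <= cumw (Dinv w k u).+1.
Proof.
move=> u0 u1; suff [i iu] : exists i : 'I_n, cumw i < u <= cumw i.+1.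
  by rewrite (Dinv_eq k iu).
have cn : u <= cumw n.
  by rewrite /cumw (eq_bigl predT) ?w_sum1// => j; rewrite ltn_ord.
have ex : exists m, u <= cumw m by exists n.
case: (ex_minnP ex) => -[|m] um mmin.
  by move: um; rewrite /cumw big1 ?leNgt ?u0// => j; rewrite ltn0.
have mn : (m < n)%N by exact: mmin.
exists (Ordinal mn) => /=; rewrite um andbT ltNge.
by apply/negP => /mmin; rewrite ltnn.
Qed.

End inverse_distribution.

Section uniform_random_variables.
Context d (T : measurableType d) (R : realType) (P : probability T R).

Lemma has_uniform_law_itv (U : {RV P >-> R}) (a b : R) (B : set R) (c e : R) :
  has_uniform_law U a b -> measurable B -> a <= c -> c <= e -> e <= b ->
  (forall u, a < u -> u < b -> B u <-> c < u <= e) ->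
  fine (P [set t | B (U t)]) = (e - c) / (b - a).
Proof.
move=> [ab law] mB ac ce eb BE; have := law _ mB.
rewrite (uniform_prob_itv ab mB ac ce eb BE) => PE.
by rewrite (_ : P _ = ((e - c) / (b - a))%:E).
Qed.

Lemma mutually_independent_pair (n : nat) (U : 'I_n -> {RV P >-> R})
    (i j : 'I_n) (B C : set R) :
  mutually_independent U -> i != j -> measurable B -> measurable C ->
  fine (P ([set t | B (U i t)] `&` [set t | C (U j t)])) =
  fine (P [set t | B (U i t)]) * fine (P [set t | C (U j t)]).
Proof.
move=> indep ij mB mC.
have mU k D : measurable D -> P (U k @^-1` D) \is a fin_num.
  by move=> mD; apply: fin_num_measure; exact: measurable_funPTI.
pose D k := if k == i then B else C.
have /indep : forall k, measurable (D k) by move=> k; rewrite /D; case: ifP.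
move=> /(_ [set i; j]%SET).
rewrite big_setU1 ?inE//= big_set1 /D eqxx eq_sym (negbTE ij).
rewrite (_ : \bigcap_(k in _) _ = [set t | B (U i t)] `&` [set t | C (U j t)]).
  by move=> ->; rewrite fineM ?mU.
apply/seteqP; split => t /=.
  move=> h; split.
    by have := h i; rewrite /= !inE eqxx => /(_ isT).
  have := h j; rewrite /= !inE eqxx orbT => /(_ isT).
  by rewrite eq_sym (negbTE ij).
move=> [Bt Ct] k /=; rewrite !inE => /orP[]/eqP->; rewrite ?eqxx//.
by rewrite eq_sym (negbTE ij).
Qed.

End uniform_random_variables.

(** * Cumulative weights and strata of the alternating system *)

Lemma sum_alternating (R : realType) (n : nat) (a b : R) : ~~ odd n ->
  \sum_(i < n) (if odd i then a else b) = n%:R / 2 * (a + b).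
Proof.
move=> /even_halfK <-; elim: n./2 => [|m IH].
  by rewrite big_ord0 !mul0r.
by rewrite doubleS !big_ord_recr/= IH odd_double/= -!natr1; field.
Qed.

Section alternating_weights.
Context (R : realType) (n : nat) (omega : R).
Hypotheses (n_gt0 : (0 < n)%N) (n_even : ~~ odd n).
Local Notation w := (alternating_weights omega n).

(** Two consecutive weights sum to 2/n, so the boundaries hit the grid point m/n for even m; for odd
    m they fall short of it by (2 omega - 1)/n. *)
Lemma cumw_alternating (m : nat) : (m <= n)%N ->
  cumw w m = m%:R / n%:R + (if odd m then (1 - 2 * omega) / n%:R else 0).
Proof.
elim: m => [_|m IH mn]; first by rewrite /cumw big1 ?mul0r ?add0r.
rewrite (cumwS w (Ordinal mn)) IH ?(ltnW mn)// /alternating_weights -natr1/=.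
by case: (odd m) => /=; ring.
Qed.

Let n_neq0 : n%:R != 0 :> R.
Proof. by rewrite pnatr_eq0 -lt0n. Qed.

Hypotheses (omega_ge : 2^-1 <= omega) (omega_lt1 : omega < 1).

Let omega2_ge1 : 1 <= 2 * omega.
Proof. by rewrite mulrC -ler_pdivrMr// div1r. Qed.

Lemma is_weights_alternating : is_weights w.
Proof.
have o1 : omega < 1 by [].
have o2 : 1 <= 2 * omega by [].
split=> [i|].
  have h0 : 0 <= 2 * (1 - omega) by lra.
  have h1 : 0 <= 2 * omega by lra.
  by rewrite /alternating_weights; case: ifP => _; rewrite divr_ge0 ?ler0n.
transitivity (cumw w n).
  by rewrite /cumw; apply: eq_bigl => i; rewrite ltn_ord.
by rewrite cumw_alternating// (negbTE n_even) addr0 divff.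
Qed.

Let w_ge0 : forall i, 0 <= w i.
Proof. by case: is_weights_alternating. Qed.

(* On the i-th stratum the index is i for odd i and one of i, i+1 for even i. *)
Lemma odd_Dinv_stratum (k i : 'I_n) (u : R) :
  i%:R / n%:R < u -> u < i.+1%:R / n%:R ->
  odd (Dinv w k u) = odd i || (cumw w i.+1 < u).
Proof.
move=> iu ui.
have o1 : omega < 1 by [].
have o2 : 1 <= 2 * omega by [].
have n0 : 0 < n%:R^-1 :> R by rewrite invr_gt0 ltr0n.
have ci : cumw w i < u.
  rewrite cumw_alternating ?(ltnW (ltn_ord i))//; case: ifP => _; last lra.
  have h : 0 <= 2 * omega - 1 by lra.
  have := mulr_ge0 h (ltW n0).
  rewrite (_ : 1 - 2 * omega = - (2 * omega - 1)) ?mulNr; lra.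
have [ucum|cumu] := leP u (cumw w i.+1).
  by rewrite orbF (Dinv_eq w_ge0 k (i := i))// ci.
rewrite orbT; case oi : (odd i).
  by move: cumu; rewrite cumw_alternating//= oi addr0; lra.
(* Being even, [i] is not the last index n - 1, so [i.+1] is an index; its bracket extends to (i +
   2)/n and covers the rest of the stratum. *)
have i1n : (i.+1 < n)%N.
  rewrite ltn_neqAle ltn_ord andbT; apply: contraNneq n_even => <-.
  by rewrite /= oi.
rewrite (Dinv_eq w_ge0 k (i := Ordinal i1n))/= ?oi// cumu/=.
rewrite cumw_alternating//= oi/= addr0 (le_trans (ltW ui))//.
by rewrite ler_pM2r// ler_nat.
Qed.

End alternating_weights.

(** * Variance of the resampled mean from the parities of the indices *)

Section resampled_mean.
Context (R : realType) (X : Type) (f : X -> R) (x0 x1 : X).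
Context d (T : measurableType d) (P : probability T R).
Context (n : nat) (A : 'I_n -> T -> 'I_n).
Hypothesis n_gt0 : (0 < n)%N.
Local Notation mean := (resampled_mean f (alternating_particles x0 x1 n) A).

Lemma resampled_mean_alternating : mean = fun t =>
  f x0 + (f x1 - f x0) / n%:R * \sum_(i < n) (odd (A i t))%:R.
Proof.
have n_neq0 : n%:R != 0 :> R by rewrite pnatr_eq0 -lt0n.
apply/funext => t; rewrite /resampled_mean.
have -> : \sum_(i < n) f (alternating_particles x0 x1 n (A i t)) =
    \sum_(i < n) (f x0 + (f x1 - f x0) * (odd (A i t))%:R).
  apply: eq_bigr => i _; rewrite /alternating_particles.
  by case: odd => /=; ring.
rewrite big_split/= sumr_const card_ord -mulr_sumr -[f x0 *+ n]mulr_natl.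
by rewrite mulrDr mulKf//; congr (_ + _); ring.
Qed.

Lemma variance_resampled_mean :
  (forall i, measurable [set t | odd (A i t)]) ->
  'V_P[mean] = (((f x1 - f x0) / n%:R) ^+ 2 * \sum_(i < n) \sum_(j < n)
    (fine (P ([set t | odd (A i t)] `&` [set t | odd (A j t)])) -
     fine (P [set t | odd (A i t)]) * fine (P [set t | odd (A j t)])))%:E.
Proof.
move=> mA; rewrite resampled_mean_alternating.
rewrite -(variance_sum_indic P _ (f x0))//.
congr variance; apply/funext => t; congr (_ + _ * _); apply: eq_bigr => i _.
rewrite indicE; case: (boolP (odd (A i t))) => [oA|/negP oA].
  by rewrite mem_set.
by rewrite memNset.
Qed.

(** Independence kills the off-diagonal covariances; the diagonal consists of Bernoulli
    variances. *)
Lemma variance_resampled_mean_indep (w : 'I_n -> R) (U : 'I_n -> {RV P >-> R})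
    (p : 'I_n -> R) :
  mutually_independent U -> (forall i t, A i t = Dinv w i (U i t)) ->
  (forall i, fine (P [set t | odd (A i t)]) = p i) ->
  'V_P[mean] = (((f x1 - f x0) / n%:R) ^+ 2 * \sum_(i < n) p i * (1 - p i))%:E.
Proof.
move=> indep AE pE.
pose B i : set R := [set u | odd (Dinv w i u)].
have mB i : measurable (B i).
  exact: (measurable_Dinv_preimage w i (fun j => odd j)).
have BE i : [set t | odd (A i t)] = [set t | B i (U i t)].
  by apply/seteqP; split=> t /=; rewrite /B /= AE.
rewrite variance_resampled_mean; last first.
  move=> i; rewrite BE (_ : mkset _ = U i @^-1` (B i))//.
  exact: measurable_funPTI.
congr (_ * _)%:E; apply: eq_bigr => i _; rewrite (bigD1 i)//= big1 ?addr0.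
  by rewrite setIid pE; ring.
move=> j ji; rewrite !BE mutually_independent_pair ?subrr//.
by rewrite eq_sym.
Qed.

End resampled_mean.

(** * Multinomial, stratified and systematic variances *)

Section variance_formulas.
Context (R : realType) (X : Type) (f : X -> R) (x0 x1 : X).
Context d (T : measurableType d) (P : probability T R).
Context (n : nat) (A : 'I_n -> T -> 'I_n) (omega : R).
Hypotheses (n_ge2 : (2 <= n)%N) (n_even : ~~ odd n).
Hypotheses (omega_ge : 2^-1 <= omega) (omega_lt1 : omega < 1).
Local Notation w := (alternating_weights omega n).
Local Notation V := 'V_P[resampled_mean f (alternating_particles x0 x1 n) A].

Let n_gt0 : (0 < n)%N. Proof. exact: ltnW. Qed.

Let n_neq0 : n%:R != 0 :> R. Proof. by rewrite pnatr_eq0 -lt0n. Qed.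

Let ninv_gt0 : 0 < n%:R^-1 :> R. Proof. by rewrite invr_gt0 ltr0n. Qed.

Let omega2_ge1 : 1 <= 2 * omega.
Proof. by rewrite mulrC -ler_pdivrMr// div1r. Qed.

(** Each index is odd with probability omega, the total weight of the odd particles. *)
Lemma variance_multinomial : multinomial_resampling P w A ->
  V = (n%:R^-1 * (1 - omega) * omega * (f x1 - f x0) ^+ 2)%:E.
Proof.
have [w_ge0 w_sum] := is_weights_alternating n_gt0 n_even omega_ge omega_lt1.
move=> [U [indep law AE]].
have PA i j : fine (P [set t | A i t = j]) = w j.
  have mD : measurable [set u : R | Dinv w i u == j].
    exact: (measurable_Dinv_preimage w i (fun k => k == j)).
  rewrite (_ : mkset _ = [set t | [set u | Dinv w i u == j] (U i t)]).
    have cj0 : 0 <= cumw w j.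
      by rewrite (_ : 0 = cumw w 0) ?le_cumw// /cumw big1.
    have cj1 : cumw w j.+1 <= 1.
      rewrite (_ : 1 = cumw w n) ?le_cumw// -w_sum.
      by apply: eq_bigl => k; rewrite ltn_ord.
    rewrite (has_uniform_law_itv (law i) mD cj0 _ cj1).
    - by rewrite cumwS addrAC subrr add0r subr0 divr1.
    - by rewrite le_cumw.
    - move=> u u0 u1 /=; split=> [/eqP <-|h]; last exact/eqP/Dinv_eq.
      by apply: Dinv_bracket => //; exact: ltW.
  by apply/seteqP; split=> t /=; rewrite AE => /eqP.
have Podd i : fine (P [set t | odd (A i t)]) = omega.
  have mA j : measurable [set t | A i t = j].
    rewrite (_ : mkset _ = U i @^-1` [set u | Dinv w i u == j]).
      apply: measurable_funPTI.
      exact: (measurable_Dinv_preimage w i (fun k => k == j)).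
    by apply/seteqP; split=> t /=; rewrite AE => /eqP.
  (* The probability of an odd index is found by computing the mean of its parity in two ways: over
     the values of [A i] ([E1]) and as an indicator ([E2]). *)
  have [_ E1] := has_mean_finite_range P (fun j : 'I_n => (odd j)%:R) mA.
  have mO : measurable [set t | odd (A i t)].
    rewrite (_ : mkset _ = U i @^-1` [set u | odd (Dinv w i u)]).
      apply: measurable_funPTI.
      exact: (measurable_Dinv_preimage w i (fun k => odd k)).
    by apply/seteqP; split=> t /=; rewrite AE.
  have [_ E2] := has_mean_indic P mO.
  have : (fine (P [set t | odd (A i t)]))%:E =
      (\sum_(j < n) (odd j)%:R * fine (P [set t | A i t = j]))%:E :> \bar R.
    rewrite -E1 -E2; apply: eq_integral => t _; rewrite indicE.
    case: (boolP (odd (A i t))) => [oA|/negP oA]; first by rewrite mem_set.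
    by rewrite memNset.
  move=> [->].
  transitivity (\sum_(j < n) (if odd j then 2 * omega / n%:R else 0)).
    apply: eq_bigr => j _; rewrite PA /alternating_weights.
    by case: odd; rewrite ?mul1r ?mul0r.
  by rewrite sum_alternating//; field.
rewrite (variance_resampled_mean_indep _ _ _ n_gt0 indep AE Podd).
by rewrite sumr_const card_ord -mulr_natl; congr EFin; field.
Qed.

Let stratum (i : 'I_n) :=
  @odd_Dinv_stratum _ _ _ n_gt0 n_even omega_ge omega_lt1 i i.

Lemma variance_stratified : stratified_resampling P w A ->
  V = (n%:R^-1 * (2 * omega - 1) * (1 - omega) * (f x1 - f x0) ^+ 2)%:E.
Proof.
have o1 : omega < 1 by [].
have o2 : 1 <= 2 * omega by [].
have n0 : 0 < n%:R^-1 :> R by [].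
move=> [U [indep law AE]].
(* Counting from 0, the interior of an odd stratum is sent to x1, whereas that of an even one is
   sent to x1 only beyond [cumw w i.+1], a fraction 2 omega - 1 of its length. *)
pose p (i : 'I_n) := if odd i then 1 else 2 * omega - 1.
have Podd i : fine (P [set t | odd (A i t)]) = p i.
  have mD : measurable [set u : R | odd (Dinv w i u)].
    exact: (measurable_Dinv_preimage w i (fun k => odd k)).
  have -> : [set t | odd (A i t)] =
      [set t | [set u | odd (Dinv w i u)] (U i t)].
    by apply/seteqP; split=> t /=; rewrite AE.
  have i1 : i.+1%:R / n%:R = i%:R / n%:R + n%:R^-1 :> R.
    by rewrite -natr1 mulrDl mul1r.
  have ci : cumw w i.+1 = i.+1%:R / n%:R -
      (if odd i then 0 else (2 * omega - 1) * n%:R^-1).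
    rewrite cumw_alternating//= if_neg; case: odd; rewrite ?addr0 ?subr0//.
    by rewrite -opprB mulNr.
  have h0 : 0 <= 2 * omega - 1 by lra.
  have c0 := mulr_ge0 h0 (ltW ninv_gt0).
  have h1 : 0 <= 2 - 2 * omega by lra.
  have c1 := mulr_ge0 h1 (ltW ninv_gt0).
  have [oi|ei] := boolP (odd i).
    rewrite (has_uniform_law_itv (law i) mD (lexx _) _ (lexx _)).
    - by rewrite /p oi divff// i1 addrAC subrr add0r gt_eqF.
    - by rewrite i1; lra.
    - move=> u iu ui /=; rewrite stratum// oi iu/=.
      by rewrite (ltW ui).
  rewrite (negbTE ei) in ci.
  rewrite (has_uniform_law_itv (c := cumw w i.+1) (law i) mD _ _ (lexx _)).
  - have -> : i.+1%:R / n%:R - i%:R / n%:R = n%:R^-1 :> R.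
      by rewrite i1 addrAC subrr add0r.
    by rewrite ci opprB addrCA subrr addr0 /p (negbTE ei) mulfK ?invr_neq0.
  - by rewrite ci i1; lra.
  - by rewrite ci; lra.
  - move=> u iu ui /=; rewrite stratum//.
    by rewrite (negbTE ei) /= (ltW ui) andbT.
rewrite (variance_resampled_mean_indep _ _ _ n_gt0 indep AE Podd).
under eq_bigr => i _.
  rewrite (_ : _ * _ = if odd i then 0 else
    (2 * omega - 1) * (1 - (2 * omega - 1))).
  over.
  by rewrite /p; case: odd; rewrite ?subrr ?mulr0.
by rewrite sum_alternating//; congr EFin; field.
Qed.

Lemma variance_systematic : systematic_resampling P w A ->
  V = ((omega - 2^-1) * (1 - omega) * (f x1 - f x0) ^+ 2)%:E.
Proof.
have o1 : omega < 1 by [].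
have o2 : 1 <= 2 * omega by [].
have n0 : 0 < n%:R^-1 :> R by [].
move=> [U [law AE]].
pose B (i : 'I_n) : set R := [set u | odd (Dinv w i (i%:R / n%:R + u))].
have mB i : measurable (B i).
  have mD : measurable [set u : R | odd (Dinv w i u)].
    exact: (measurable_Dinv_preimage w i (fun k => odd k)).
  have mf : measurable_fun [set: R] (fun u : R => i%:R / n%:R + u).
    exact: measurable_funD.
  by have := mf measurableT _ mD; rewrite setTI.
(* Length of the initial part of an even stratum that is sent to x0. It is the same for all even
   [i], so the single event that [U] exceeds [c] decides all of them. *)
pose c := (2 - 2 * omega) * n%:R^-1.
have h1 : 0 <= 2 - 2 * omega by lra.
have c0 : 0 <= c := mulr_ge0 h1 (ltW ninv_gt0).
have h0 : 0 <= 2 * omega - 1 by lra.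
have c1 := mulr_ge0 h0 (ltW ninv_gt0).
have cn : c = n%:R^-1 - (2 * omega - 1) * n%:R^-1 by rewrite /c; ring.
have BE (i : 'I_n) u : 0 < u -> u < n%:R^-1 -> B i u <-> odd i || (c < u).
  move=> u0 un; rewrite /B /= stratum//; last 2 first.
  - lra.
  - by rewrite -natr1 mulrDl; lra.
  case oi: (odd i) => //=.
  rewrite cumw_alternating//= oi/= (_ : _ + _ = i%:R / n%:R + c) ?ltrD2l//.
  by rewrite -natr1 /c; ring.
pose p (b : bool) := if b then 1 else 2 * omega - 1.
have PB (C : set R) (b : bool) : measurable C ->
    (forall u, 0 < u -> u < n%:R^-1 -> C u <-> b || (c < u)) ->
    fine (P [set t | C (U t)]) = p b.
  case: b => mC CE.
    rewrite (has_uniform_law_itv law mC (lexx _) _ (lexx _)).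
    - by rewrite divff// subr0 gt_eqF.
    - exact: ltW.
    - by move=> u u0 un; rewrite u0 (ltW un); exact: CE.
  rewrite (has_uniform_law_itv (c := c) law mC _ _ (lexx _)) ?cn.
  - by rewrite /p; field.
  - by rewrite -cn.
  - lra.
  - by move=> u u0 un; rewrite -cn (ltW un) andbT; exact: CE.
have AB i : [set t | odd (A i t)] = [set t | B i (U t)].
  by apply/seteqP; split=> t /=; rewrite AE.
rewrite variance_resampled_mean//; last first.
  move=> i; rewrite AB (_ : mkset _ = U @^-1` (B i))//.
  exact: measurable_funPTI.
under eq_bigr => i _.
  rewrite (_ : \sum_(j < n) _ = if odd i then 0 else
    n%:R / 2 * ((2 * omega - 1) * (2 - 2 * omega))).
  over.
  (* Odd strata are deterministic, so only pairs of even [i] and [j] contribute, each with the full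
     variance of one choice. *)
  transitivity (\sum_(j < n) (if odd j then 0 else if odd i then 0 else
      (2 * omega - 1) * (2 - 2 * omega))).
    apply: eq_bigr => j _; rewrite !AB.
    rewrite (PB _ _ (mB i) (BE i)) (PB _ _ (mB j) (BE j)).
    have -> : [set t | B i (U t)] `&` [set t | B j (U t)] =
       [set t | (B i `&` B j) (U t)] by [].
    rewrite (PB _ (odd i && odd j)); last 2 first.
    - exact: measurableI.
    - move=> u u0 un; split=> [[/(BE _ _ u0 un) + /(BE _ _ u0 un)]|].
        by case: (odd i); case: (odd j).
      by move=> h; split; apply/(BE _ _ u0 un); move: h; do 2!case: odd.
    by rewrite /p; do 2!case: odd => /=; ring.
  by rewrite sum_alternating// add0r; case: odd; rewrite ?mulr0.
by rewrite sum_alternating//; congr EFin; field.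
Qed.

End variance_formulas.

(** * Multinomial law and residual resampling *)

Section multinomial_theorem.
Context (F : numFieldType) (K : comNzRingType) (g : {rmorphism F -> K}).

(* The exponential series of [a 'X] truncated after degree [m]. Both sides of
   the multinomial theorem are [m`!] times the coefficient of degree [m] in the
   product of the [texp m (a i)]. *)
Let texp (m : nat) (a : K) : {poly K} :=
  \poly_(k < m.+1) (g k`!%:R^-1 * a ^+ k).

Let coef_prod_texp (m : nat) (I : Type) (r : seq I) (a : I -> K) (k : nat) :
  (k <= m)%N -> (\prod_(i <- r) texp m (a i))`_k =
  g k`!%:R^-1 * (\sum_(i <- r) a i) ^+ k.
Proof.
elim: r k => [|i r IH] k km.
  rewrite !big_nil coef1; case: k km => [|k] _.
    by rewrite expr0 fact0 invr1 (rmorph1 g) mul1r.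
  by rewrite expr0n mulr0.
rewrite !big_cons addrC exprDn coefM mulr_sumr; apply: eq_bigr => j _.
have jk : (j <= k)%N by rewrite -ltnS.
rewrite IH ?(leq_trans (leq_subr _ _))// coef_poly ltnS (leq_trans jk)//.
have gC : 'C(k, j)%:R = g 'C(k, j)%:R by rewrite rmorph_nat.
rewrite -(mulr_natl _ 'C(k, j)) gC.
(* The binomial coefficient of [exprDn] is absorbed by the inverse factorials. *)
have -> : k`!%:R^-1 = j`!%:R^-1 * (k - j)`!%:R^-1 / 'C(k, j)%:R :> F.
  by rewrite -(bin_fact jk) !natrM !invfM; ring.
rewrite !(rmorphM g).
rewrite [RHS](_ : _ = (g 'C(k, j)%:R^-1 * g 'C(k, j)%:R) *
  (g j`!%:R^-1 * a i ^+ j *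
   (g (k - j)`!%:R^-1 * (\sum_(j0 <- r) a j0) ^+ (k - j)))); last by ring.
by rewrite -(rmorphM g) mulVf ?(rmorph1 g) ?mul1r// pnatr_eq0 -lt0n bin_gt0.
Qed.

(** Factorials are inverted in [F] while the [a i] live in [K]: the use below takes [{poly R}] for
    [K] and [polyC] for [g], to obtain a generating function. *)
Lemma multinomial_theorem (n m : nat) (a : 'I_n -> K) :
  (\sum_(i < n) a i) ^+ m =
  \sum_(c : {ffun 'I_n -> 'I_m.+1} | (\sum_(i < n) c i == m)%N)
    g (m`!%:R / (\prod_(i < n) (c i)`!)%N%:R) * \prod_(i < n) a i ^+ c i.
Proof.
have -> : (\sum_(i < n) a i) ^+ m =
    g m`!%:R * (\prod_(i < n) texp m (a i))`_m.
  rewrite coef_prod_texp// mulrA -(rmorphM g) mulfV ?(rmorph1 g) ?mul1r//.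
under eq_bigr do rewrite /texp poly_def.
(* Distributing the product picks one exponent [c i] per factor; the coefficient of degree [m]
   retains the choices of total [m]. *)
rewrite bigA_distr_bigA/= coef_sum mulr_sumr [RHS]big_mkcond/=.
apply: eq_bigr => c _.
have -> : \prod_(i < n) ((g (c i)`!%:R^-1 * a i ^+ c i) *: 'X^(c i)) =
    (g (\prod_(i < n) (c i)`!)%N%:R^-1 * \prod_(i < n) a i ^+ c i)
      *: 'X^(\sum_(i < n) c i).
  elim: (index_enum _) => [|i r IH]; rewrite ?big_nil ?big_cons.
    by rewrite invr1 (rmorph1 g) mul1r scale1r.
  rewrite IH natrM invfM (rmorphM g) exprD -!mul_polyC !polyCM; ring.
rewrite coefZ coefXn eq_sym; case: eqP => _; last by rewrite mulr0 mulr0.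
by rewrite (rmorphM g) mulr1 mulrA.
Qed.

End multinomial_theorem.

(* The hypothesis says that [S] has the generating function of the binomial law
   under the weights [q]; its derivatives at 1 are the factorial moments. *)
Lemma binomial_moments (R : realType) (J : finType) (q : J -> R)
    (S : J -> nat) (m : nat) (x : R) :
  \sum_j q j *: 'X^(S j) = ((1 - x)%:P + x *: 'X) ^+ m ->
  \sum_j q j * (S j)%:R = m%:R * x /\
  \sum_j q j * ((S j)%:R - m%:R * x) ^+ 2 = m%:R * x * (1 - x).
Proof.
move=> E; set L : {poly R} := (1 - x)%:P + x *: 'X in E.
have L1 k : (L ^+ k).[1] = 1.
  by rewrite /L !hornerE/= subrK expr1n.
have L' : L^`() = x%:P.
  by rewrite /L derivD derivC derivZ derivX add0r alg_polyC.
have D1 k : ((L ^+ k)^`()).[1] = k%:R * x.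
  by rewrite deriv_exp L' hornerMn hornerM L1 hornerC; ring.
have D2 : ((L ^+ m)^`()^`()).[1] = m%:R * (m%:R - 1) * x ^+ 2.
  rewrite deriv_exp L' derivMn derivM derivC mul0r add0r hornerMn hornerM D1.
  (* The derivative produces the truncated predecessor of [m], hence the separate case of 0. *)
  by rewrite hornerC; case: m {E} => [|k] /=; rewrite -?natr1; ring.
have S0 : \sum_j q j = 1.
  rewrite -(L1 m) -E horner_sum; apply: eq_bigr => j _.
  by rewrite !hornerE expr1n mulr1.
have S1 : \sum_j q j * (S j)%:R = m%:R * x.
  rewrite -D1 -E raddf_sum horner_sum; apply: eq_bigr => j _ /=.
  by rewrite derivZ derivXn !hornerE hornerMn hornerXn expr1n.
have S2 : \sum_j q j * ((S j)%:R * ((S j)%:R - 1)) = m%:R * (m%:R - 1) * x ^+ 2.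
  rewrite -D2 -E !raddf_sum horner_sum; apply: eq_bigr => j _ /=.
  rewrite !derivZ derivXn derivMn derivXn !hornerE !hornerMn hornerXn expr1n.
  by case: (S j) => [|s] /=; rewrite -?natr1; ring.
split=> //; set u := m%:R * x in S1 *.
(* The identity (s - u)^2 = s (s - 1) + (1 - 2 u) s + u^2 recovers the centred moment from the
   factorial ones. *)
transitivity (\sum_j (q j * ((S j)%:R * ((S j)%:R - 1)) +
    (1 - 2 * u) * (q j * (S j)%:R) + u ^+ 2 * q j)).
  by apply: eq_bigr => j _; ring.
by rewrite !big_split/= -!mulr_sumr S0 S1 S2 /u; ring.
Qed.

Section residual.
Context (R : realType) (X : Type) (f : X -> R) (x0 x1 : X).
Context d (T : measurableType d) (P : probability T R).
Context (n : nat) (A : 'I_n -> T -> 'I_n).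

(** The number of trials landing in [Q] is binomial: marking the outcomes in [Q] by ['X] in the
    multinomial theorem gives its generating function, to which [binomial_moments] applies. *)
Lemma has_multinomial_law_count (N : 'I_n -> {RV P >-> nat}) (m : nat)
    (p : 'I_n -> R) (Q : pred 'I_n) :
  has_multinomial_law N m p -> \sum_(i < n) p i = 1 ->
  (forall t, (\sum_(i < n) N i t = m)%N) ->
  let S t := (\sum_(i < n | Q i) N i t)%:R in
  let x := \sum_(i < n | Q i) p i in
  has_mean P S (m%:R * x) /\
  has_mean P (fun t => (S t - m%:R * x) ^+ 2) (m%:R * x * (1 - x)).
Proof.
move=> law p1 Nm S x.
have Nle i t : (N i t <= m)%N by rewrite -(Nm t) (bigD1 i)//= leq_addr.
(* No count exceeds [m], so the vector of counts has finite range and [inord] loses nothing. *)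
pose J := {ffun 'I_n -> 'I_m.+1}.
pose Z t : J := [ffun i => inord (N i t)].
pose s (c : J) := (\sum_(i < n | Q i) c i)%N.
have ZE t i : Z t i = N i t :> nat by rewrite ffunE inordK// ltnS.
have fiber c : [set t | Z t = c] = [set t | forall i, N i t = c i].
  apply/seteqP; split=> t /=; first by move=> <- i; rewrite ZE.
  by move=> h; apply/ffunP => i; apply: val_inj; rewrite /= ZE.
have mZ c : measurable [set t | Z t = c].
  rewrite fiber (_ : mkset _ =
    \bigcap_(i in [set: 'I_n]) (N i @^-1` [set (c i : nat)])).
    by apply: fin_bigcap_measurable => // i _; exact: measurable_funPTI.
  by apply/seteqP; split=> t /= h i; [move=> _|]; exact: h.
pose q c := fine (P [set t | Z t = c]).
have SE : S = fun t => (s (Z t))%:R.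
  by apply/funext => t; congr _%:R; apply: eq_bigr => i _; rewrite ZE.
have G : \sum_c q c *: 'X^(s c) = ((1 - x)%:P + x *: 'X) ^+ m.
  have -> : (1 - x)%:P + x *: 'X =
      \sum_(i < n) (p i)%:P * (if Q i then 'X else 1) :> {poly R}.
    rewrite (bigID Q)/= [in RHS]addrC; congr (_ + _).
      rewrite -p1 (bigID Q)/= addrAC subrr add0r rmorph_sum.
      by apply: eq_bigr => i /negbTE->; rewrite mulr1.
    rewrite scaler_suml; apply: eq_bigr => i ->.
    by rewrite mul_polyC.
  rewrite (multinomial_theorem (@polyC R)) [RHS]big_mkcond/=.
  apply: eq_bigr => c _; rewrite /q fiber law; case: eqP => _ /=.
    rewrite -mul_polyC rmorphM -mulrA; congr (_ * _).
    under [RHS]eq_bigr do rewrite exprMn.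
    rewrite big_split/= rmorph_prod; congr (_ * _).
      by apply: eq_bigr => i _; rewrite rmorphXn.
    rewrite /s expr_sum big_mkcond/=; apply: eq_bigr => i _.
    by case: ifP => _; rewrite ?expr1n.
  by rewrite scale0r.
have [E1 E2] := binomial_moments G.
split.
  rewrite SE -E1; have := has_mean_finite_range P (fun c => (s c)%:R) mZ.
  by congr has_mean; apply: eq_bigr => c _; rewrite mulrC.
rewrite SE -E2.
have := has_mean_finite_range P (fun c => ((s c)%:R - m%:R * x) ^+ 2) mZ.
by congr has_mean; apply: eq_bigr => c _; rewrite mulrC.
Qed.

End residual.

(** Double counting; it turns the copy numbers prescribed by residual resampling into the number of
    odd indices. *)
Lemma card_fibers (n : nat) (a : 'I_n -> 'I_n) (Q : pred 'I_n) :
  (\sum_(i < n | Q i) #|[set k | a k == i]%SET| = \sum_(k < n) Q (a k))%N.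
Proof.
have cE i : #|[set k | a k == i]%SET| = (\sum_(k < n) (a k == i))%N.
  rewrite cardsE -sum1_card big_mkcond; apply: eq_bigr => k _.
  by rewrite -[k \in _]/(a k == i); case: (a k == i).
under eq_bigr do rewrite cE.
rewrite exchange_big; apply: eq_bigr => k _.
rewrite big_mkcond (bigD1 (a k))//= big1 ?addn0 ?eqxx; first by case: (Q _).
by move=> i ik; rewrite eq_sym (negbTE ik); case: ifP.
Qed.

(** * Variance under residual resampling *)

Section variance_residual.
Context (R : realType) (X : Type) (f : X -> R) (x0 x1 : X).
Context d (T : measurableType d) (P : probability T R).
Context (n : nat) (A : 'I_n -> T -> 'I_n) (omega : R).
Hypotheses (n_ge2 : (2 <= n)%N) (n_even : ~~ odd n).
Hypotheses (omega_ge : 2^-1 <= omega) (omega_lt1 : omega < 1).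
Local Notation w := (alternating_weights omega n).
Local Notation V := 'V_P[resampled_mean f (alternating_particles x0 x1 n) A].

(** The scaled weight n w is 2 omega, in [1, 2[, at odd particles and 2 (1 - omega), in ]0, 1], at
    even ones. For omega > 1/2 the floors are thus 1 and 0, and n/2 random copies remain. *)
Lemma variance_residual : residual_resampling P w A ->
  V = (n%:R^-1 * (2 * omega - 1) * (1 - omega) * (f x1 - f x0) ^+ 2)%:E.
Proof.
have o1 : omega < 1 by [].
have o2 : 1 <= 2 * omega by rewrite mulrC -ler_pdivrMr// div1r.
have n_gt0 : (0 < n)%N by exact: ltnW.
have n_neq0 : n%:R != 0 :> R by rewrite pnatr_eq0 -lt0n.
set F := fun i => Num.truncn (n%:R * w i).
set m := (n - \sum_(i < n) F i)%N.
move=> [N [law NE]].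
have nw i : n%:R * w i = if odd i then 2 * omega else 2 * (1 - omega).
  by rewrite /alternating_weights; case: odd; field.
(* The multinomial law fixes this total only almost surely; here it holds at every [t], since the
   copies of all particles number n. *)
have Fsum t : (\sum_(i < n) N i t = m)%N.
  have : (\sum_(i < n) #|[set k | A k t == i]%SET| = n)%N.
    by rewrite (card_fibers _ predT)/= sum1_card card_ord.
  under eq_bigr do rewrite NE.
  rewrite big_split/= /m => /(congr1 (subn^~ (\sum_(i < n) F i)%N)).
  by rewrite addKn.
have oddE t : (\sum_(k < n) (odd (A k t)) =
    \sum_(i < n | odd i) (F i + N i t))%N.
  by rewrite -(card_fibers _ (fun i : 'I_n => odd i)); apply: eq_bigr => i _.
rewrite (resampled_mean_alternating _ _ _ _ n_gt0).
set D := f x1 - f x0.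
pose S t : R := (\sum_(i < n | odd i) N i t)%:R.
pose K : R := (\sum_(i < n | odd i) F i)%:R.
have -> : (fun t => f x0 + D / n%:R * \sum_(i < n) (odd (A i t))%:R) =
    (fun t => (f x0 + D / n%:R * K) + D / n%:R * S t).
  apply/funext => t; rewrite -natr_sum oddE big_split/= natrD.
  by rewrite -/K -/(S t); ring.
have Fodd (i : 'I_n) : odd i -> F i = 1%N.
  move=> oi; rewrite /F nw oi; apply/eqP; rewrite truncn_eq; last lra.
  by apply/andP; split; rewrite -?natr1; lra.
(* At omega = 1/2 every floor is 1 and no trial is left: the mean is constant and both sides
   vanish. *)
have [wh | wgt] := eqVneq (2 * omega) 1.
  have Feven (i : 'I_n) : F i = 1%N.
    case oi : (odd i); first exact: Fodd.
    rewrite /F nw oi (_ : 2 * (1 - omega) = 1); last lra.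
    exact: truncn1.
  have m0 : m = 0%N.
    rewrite /m; under eq_bigr do rewrite Feven.
    by rewrite sum1_card card_ord subnn.
  rewrite (_ : (fun t => _ + _ * S t) = cst (f x0 + D / n%:R * K)).
    by rewrite variance_cst wh subrr mulr0 !mul0r.
  apply/funext => t; rewrite /S big1 ?mulr0 ?addr0// => i _.
  apply/eqP; move: (Fsum t); rewrite m0 => /eqP.
  by rewrite sum_nat_eq0 => /forallP/(_ i).
have o3 : 1 < 2 * omega by rewrite lt_neqAle eq_sym wgt.
have Feven (i : 'I_n) : ~~ odd i -> F i = 0%N.
  move=> /negbTE oi; rewrite /F nw oi; apply/eqP; rewrite truncn_eq; last lra.
  by apply/andP; split; lra.
have FE (i : 'I_n) : (F i)%:R = (if odd i then 1 else 0) :> R.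
  by case: (boolP (odd i)) => oi; [rewrite Fodd|rewrite Feven].
have mE : m%:R = n%:R / 2 :> R.
  have FR : (\sum_(i < n) F i)%:R = n%:R / 2 :> R.
    rewrite natr_sum; under eq_bigr do rewrite FE.
    by rewrite sum_alternating// addr0 mulr1.
  (* The truncated subtraction in [m] is exact because the floors sum to n/2 <= n. *)
  rewrite /m natrB ?FR; first by field.
  rewrite -(ler_nat R) FR ler_pdivrMr// ler_peMr ?ler0n//; lra.
have m_neq0 : m%:R != 0 :> R by rewrite mE mulf_neq0// invr_neq0.
pose p (i : 'I_n) := (n%:R * w i - (F i)%:R) / m%:R.
have pE i : p i =
    if odd i then (2 * omega - 1) / m%:R else 2 * (1 - omega) / m%:R.
  by rewrite /p nw FE; case: odd; rewrite ?subr0.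
have p1 : \sum_(i < n) p i = 1.
  by under eq_bigr do rewrite pE; rewrite sum_alternating// mE; field.
have [] := has_multinomial_law_count (fun i : 'I_n => odd i) law p1 Fsum.
have -> : \sum_(i < n | odd i) p i = 2 * omega - 1.
  rewrite big_mkcond/= (eq_bigr (fun i : 'I_n =>
    if odd i then (2 * omega - 1) / m%:R else 0)).
    by rewrite sum_alternating// mE; field.
  by move=> i _; rewrite pE; case: odd.
move=> h1 h2; rewrite (variance_affine _ _ h1 h2) mE.
by congr EFin; field.
Qed.

End variance_residual.

(** * Independent uniform variables *)

(** Refuting the comparison of two schemes requires actual random variables. They are built by
    induction: the product with a further uniform space adds an independent coordinate. *)
Lemma exists_iid_uniform (R : realType) (a b : R) (n : nat) : a < b ->
  exists (d : measure_display) (T : measurableType d) (P : probability T R)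
    (U : 'I_n -> {RV P >-> R}),
    mutually_independent U /\ forall i, has_uniform_law (U i) a b.
Proof.
move=> ab; pose PU : probability (measurableTypeR R) R := uniform_prob ab.
elim: n => [|n [d [T [P [U [indep law]]]]]].
  exists _, _, PU.
  have U : 'I_0 -> {RV PU >-> R} by case.
  exists U; split=> [J B mB|[]//].
  rewrite (_ : \bigcap_(i in _) _ = setT) ?probability_setT; last first.
    by apply/seteqP; split=> // t _ [].
  by rewrite big_mkcond big_ord0.
pose Q : probability (measurableTypeR R * T)%type R := (PU \x P)%E.
(* Index 0 reads the new coordinate, and [lift ord0 j] reads the old variable [U j]. *)
pose V (i : 'I_n.+1) : measurableTypeR R * T -> R :=
  if unlift ord0 i is Some j then U j \o snd else fst.
have mV i : measurable_fun setT (V i).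
  rewrite /V; case: unlift => [j|].
    by apply: measurableT_comp => //; exact: measurable_snd.
  exact: (@measurable_fst _ _ (measurableTypeR R) T).
pose mk i := isMeasurableFun.Build _ _ _ _ (V i) (mV i).
pose W i : {RV Q >-> R} := HB.pack (V i) (mk i).
exists _, _, Q, W.
have QX (B : set R) (C : set T) : measurable B -> measurable C ->
    Q (B `*` C) = (PU B * P C)%E.
  by move=> mB mC; rewrite /Q /= product_measure1E.
have W0 B : measurable B -> Q (W ord0 @^-1` B) = PU B.
  move=> mB; rewrite (_ : _ @^-1` _ = B `*` setT).
    by rewrite QX// probability_setT mule1.
  by apply/seteqP; split=> -[u t] /=; rewrite /W /= /V unlift_none//= => -[].
have WS j B : measurable B -> Q (W (lift ord0 j) @^-1` B) = P (U j @^-1` B).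
  move=> mB; rewrite (_ : _ @^-1` _ = setT `*` (U j @^-1` B)).
    rewrite QX//; last exact: measurable_funPTI.
    by rewrite probability_setT mul1e.
  by apply/seteqP; split=> -[u t] /=; rewrite /W /= /V liftK//= => -[].
split=> [J B mB|i]; last first.
  exists ab => B mB; rewrite /distribution /pushforward.
  case: (unliftP ord0 i) => [j ->|->]; last exact: W0.
  by rewrite WS//; case: (law j) => ab' /(_ _ mB).
(* The intersection over [J] is a rectangle: [B0] holds the constraint on index 0, trivial when 0 is
   not in [J], and [C] those on the older variables. *)
pose J' := [set j | lift ord0 j \in J]%SET.
pose B0 := if ord0 \in J then B ord0 else setT.
have mB0 : measurable B0 by rewrite /B0; case: ifP.
pose C := \bigcap_(j in [set` J']) (U j @^-1` B (lift ord0 j)).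
have mC : measurable C.
  by apply: fin_bigcap_measurable => // j _; exact: measurable_funPTI.
rewrite (_ : \bigcap_(i in _) _ = B0 `*` C); last first.
  apply/seteqP; split=> -[u t] /=.
    move=> h; split=> [|j /=]; rewrite /B0 ?inE.
      by case: ifP => // J0; have := h ord0 J0; rewrite /W /= /V unlift_none.
    by move=> Jj; have := h (lift ord0 j) Jj; rewrite /W /= /V liftK.
  move=> [Bu Ct] i /=; rewrite /W /= /V; case: unliftP => [j ->|->] Ji.
    by apply: (Ct j); rewrite /= inE.
  by move: Bu; rewrite /B0 Ji.
rewrite QX// indep; last by move=> j; exact: mB.
rewrite [RHS]big_mkcond big_ord_recl /=; congr (_ * _)%E.
  by rewrite /B0; case: ifP => _; rewrite ?W0// probability_setT.
rewrite big_mkcond; apply: eq_bigr => j _; rewrite inE.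
by case: ifP => // _; rewrite WS.
Qed.

(** * The four formulas, the counterexample and the failure of convergence *)

Theorem mainTheorem4 (R : realType) (X : Type) (x0 x1 : X) (hx : x0 <> x1) :
  (forall (n : nat) (omega : R) (f : X -> R)
      (d : measure_display) (T : measurableType d) (P : probability T R)
      (A : 'I_n -> T -> 'I_n),
    (2 <= n)%N -> ~~ odd n -> 2^-1 <= omega -> omega < 1 ->
    let w := alternating_weights omega n in
    let V := 'V_P[resampled_mean f (alternating_particles x0 x1 n) A] in
    let normf := `|f x1 - f x0| in
    [/\ multinomial_resampling P w A ->
          V = (n%:R^-1 * (1 - omega) * omega * normf ^+ 2)%:E,
        residual_resampling P w A ->
          V = (n%:R^-1 * (2 * omega - 1) * (1 - omega) * normf ^+ 2)%:E,
        stratified_resampling P w A ->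
          V = (n%:R^-1 * (2 * omega - 1) * (1 - omega) * normf ^+ 2)%:E
      & systematic_resampling P w A ->
          V = ((omega - 2^-1) * (1 - omega) * normf ^+ 2)%:E]) /\
  ~ (forall (n : nat) (xi : 'I_n -> X) (w : 'I_n -> R) (f : X -> R)
      (d : measure_display) (T : measurableType d) (P : probability T R)
      (A : 'I_n -> T -> 'I_n)
      (d' : measure_display) (T' : measurableType d') (P' : probability T' R)
      (A' : 'I_n -> T' -> 'I_n),
    is_weights w ->
    systematic_resampling P w A -> multinomial_resampling P' w A' ->
    ('V_P[resampled_mean f xi A] <= 'V_P'[resampled_mean f xi A'])%E) /\
  (forall (omega : R) (f : X -> R)
      (d : nat -> measure_display) (T : forall m, measurableType (d m))
      (P : forall m, probability (T m) R)
      (A : forall m, 'I_(m.+1.*2) -> T m -> 'I_(m.+1.*2)),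
    2^-1 < omega -> omega < 1 -> f x0 <> f x1 ->
    (forall m, systematic_resampling (P m)
                 (alternating_weights omega m.+1.*2) (A m)) ->
    ~ ((fun m => 'V_(P m)[resampled_mean f
                            (alternating_particles x0 x1 m.+1.*2) (A m)])
         @ \oo --> 0%E)).
Proof.
split; [|split].
- move=> n omega f d T P A n2 n_even omega_ge omega_lt1 w V normf.
  rewrite /normf real_normK ?num_real//; split.
  + exact: variance_multinomial.
  + exact: variance_residual.
  + exact: variance_stratified.
  + exact: variance_systematic.
(* For omega = 3/4, n = 4 and |f| = 1 the variances are 4/64 (systematic) and 3/64 (multinomial).
   With n = 2 the systematic variance would be the smaller one for every omega < 1. *)
- move=> H; pose omega : R := 3 / 4; pose f x : R := (`[< x = x1 >])%:R.
  have o1 : omega < 1 by rewrite /omega; lra.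
  have o2 : 2^-1 <= omega by rewrite /omega; lra.
  pose w : 'I_4 -> R := alternating_weights omega 4.
  have u4 : 0 < 4%:R^-1 :> R by rewrite invr_gt0 ltr0n.
  have [d [T [P [U [_ lawU]]]]] := exists_iid_uniform 1 u4.
  have [d' [T' [P' [U' [indep' lawU']]]]] := exists_iid_uniform 4 (@ltr01 R).
  pose A (i : 'I_4) t := Dinv w i (i%:R / 4%:R + U ord0 t).
  pose A' (i : 'I_4) t := Dinv w i (U' i t).
  have sys : systematic_resampling P w A by exists (U ord0).
  have mul : multinomial_resampling P' w A' by exists U'.
  have weights : is_weights w by exact: is_weights_alternating.
  have f1 : f x1 = 1 by rewrite /f asboolT.
  have f0 : f x0 = 0 by rewrite /f asboolF.
  have := H 4 (alternating_particles x0 x1 4) w f _ _ P A _ _ P' A'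
    weights sys mul.
  rewrite (variance_systematic f x0 x1 _ _ o2 o1 sys)//.
  rewrite (variance_multinomial f x0 x1 _ _ o2 o1 mul)// lee_fin.
  rewrite f1 f0 /omega; lra.
- move=> omega f d T P A omega_gt omega_lt1 fx sys.
  (* The systematic variance does not depend on n, so the sequence is constant; a limit 0 would
     force a factor of the constant to vanish. *)
  have -> : (fun m => 'V_(P m)[resampled_mean f
      (alternating_particles x0 x1 m.+1.*2) (A m)]) =
      cst ((omega - 2^-1) * (1 - omega) * (f x1 - f x0) ^+ 2)%:E.
    apply/funext => m; apply: variance_systematic => //.
      by rewrite odd_double.
    exact: ltW.
  move=> cvg0.
  have [/eqP] : ((omega - 2^-1) * (1 - omega) * (f x1 - f x0) ^+ 2)%:E = 0%E
      :> \bar R.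
    by rewrite -[RHS](cvg_lim (@ereal_hausdorff R) cvg0) lim_cst.
  rewrite mulf_eq0 sqrf_eq0 mulf_eq0 !subr_eq0 (gt_eqF omega_gt).
  by rewrite (gt_eqF omega_lt1) => /eqP/esym.
Qed.
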